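(* Let $A\in\mathbb{R}^{n\times n}$ be symmetric and positive definite, let $b,x_0\in\mathbb{R}^{n\times m}$, $r_0=b-Ax_0$, and let $k\ge1$ be such that $\dim\mathcal{K}_{k+1}(A,r_0)=(k+1)m$. Consider the quantities determined by the Dubrulle-R block CG algorithm (DR-BCG) applied to $A,b,x_0$, and let $\beta_1=\sigma_0$, $\theta_0=I$, and $\ell_0=0$. Then, for $j=1,\dots,k$, the block Lanczos coefficients $\alpha_j$ and $\beta_{j+1}$ (of the block Lanczos algorithm started with $A$ and $v=r_0$) forming the matrix $T_k$, and the coefficients $\ell_j$ and $d_j$ used in $T_k=L_kD_kL_k^T$, where $L_k$ is block lower bidiagonal with identity diagonal blocks and subdiagonal blocks $\ell_1,\dots,\ell_{k-1}$, and $D_k=\mathrm{diag}(d_1,\dots,d_k)$ is block diagonal, can be computed using the recurrences \[ \begin{aligned} \tilde\tau_j&=\xi_{j-1}^{-1}\theta_{j-1},\\ d_j&=\theta_{j-1}^T\tilde\tau_j,\\ \alpha_j&=d_j+\ell_{j-1}\beta_j^T,\\ [\theta_j,\beta_{j+1}]&=\mathtt{qr}(\zeta_j\tilde\tau_j),\\ \ell_j&=\theta_j^T\zeta_j\theta_{j-1}. \end{aligned} \] The Lanczos block $v_{k+1}$ can be obtained from $w_k$ as $v_{k+1}=(-1)^kw_k\theta_k^{-T}$.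
   Context: All computations are in exact arithmetic. $I$ denotes the $m\times m$ identity matrix. For $v\in\mathbb{R}^{n\times m}$, $\mathcal{K}_k(A,v)=\mathrm{colspan}\{v,Av,\dots,A^{k-1}v\}$ is the span of all columns of the blocks $v,Av,\dots,A^{k-1}v$. Notation: $[Q,R]=\mathtt{qr}(B)$ means that $B=QR$ is the QR factorization of a full column rank matrix $B$ with $m$ columns, where $Q$ has orthonormal columns and has the same size as $B$, and $R$ is $m\times m$ upper triangular with positive diagonal entries. Block Lanczos algorithm (input: symmetric $A$, $v\in\mathbb{R}^{n\times m}$): $v_0=0$; $[v_1,\beta_1]=\mathtt{qr}(v)$; for $k=1,2,\dots$: $w=Av_k-v_{k-1}\beta_k^T$; $\alpha_k=v_k^Tw$; $w\leftarrow w-v_k\alpha_k$; $[v_{k+1},\beta_{k+1}]=\mathtt{qr}(w)$. The matrix $T_k\in\mathbb{R}^{km\times km}$ is the symmetric block tridiagonal matrix with diagonal blocks $\alpha_1,\dots,\alpha_k$, subdiagonal blocks $\beta_2,\dots,\beta_k$ and superdiagonal blocks $\beta_2^T,\dots,\beta_k^T$. Dubrulle-R block CG algorithm (DR-BCG) (input: symmetric positive definite $A$, $b\in\mathbb{R}^{n\times m}$, $x_0\in\mathbb{R}^{n\times m}$): $r_0=b-Ax_0$; $[w_0,\sigma_0]=\mathtt{qr}(r_0)$; $s_0=w_0$; for $k=1,2,\dots$: $\xi_{k-1}=(s_{k-1}^TAs_{k-1})^{-1}$; $x_k=x_{k-1}+s_{k-1}\xi_{k-1}\sigma_{k-1}$;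 $[w_k,\zeta_k]=\mathtt{qr}(w_{k-1}-As_{k-1}\xi_{k-1})$; $s_k=w_k+s_{k-1}\zeta_k^T$; $\sigma_k=\zeta_k\sigma_{k-1}$. The coefficients with index $k$ are understood as belonging to the next matrices ($\beta_{k+1}$ to $T_{k+1}$, $\ell_k$ to $L_{k+1}$). *)

(* Defs.v *)
From mathcomp Require Import all_boot all_order all_algebra.
From mathcomp Require Import boolp classical_sets reals.

Set Implicit Arguments.
Unset Strict Implicit.
Unset Printing Implicit Defensive.

Import Order.TTheory GRing.Theory Num.Theory.

Local Open Scope ring_scope.

Definition spd (R : realType) (n : nat) (A : 'M[R]_n) : Prop :=
  A^T = A /\ forall x : 'cV[R]_n, x != 0 -> 0 < (x^T *m A *m x) 0 0.

Definition is_qr (R : realType) (n m : nat) (B Q : 'M[R]_(n, m)) (U : 'M[R]_m) :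
    Prop :=
  [/\ B = Q *m U,
      Q^T *m Q = 1%:M,
      forall i j : 'I_m, (j < i)%N -> U i j = 0
    & forall i : 'I_m, 0 < U i i].

(* The QR factorization exists, and is then unique, exactly when B has full
   column rank, i.e. [row_full B]; otherwise [qr B] is the junk value (0, 0). *)
Definition qr (R : realType) (n m : nat) (B : 'M[R]_(n, m)) :
    'M[R]_(n, m) * 'M[R]_m :=
  xget (0, 0) [set QU : 'M[R]_(n, m) * 'M[R]_m | is_qr B QU.1 QU.2]%classic.

(* Subspaces are row spaces in MathComp, whence the transposes: the row space
   of [krylov A v k] is the span of the (transposed) columns of
   v, A v, ..., A^(k-1) v, and its dimension is [\rank (krylov A v k)]. *)
Definition krylov (R : realType) (n m : nat) (A : 'M[R]_n) (v : 'M[R]_(n, m))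
    (k : nat) : 'M[R]_n :=
  (\sum_(i < k) <<(A ^+ i *m v)^T>>)%MS.

(* Since [qr] and [invmx] are total, the two algorithms below never stop: the
   sequences exist and are unique (up to the entries no algorithm line assigns,
   such as alpha 0), but are only meaningful as long as every argument of [qr]
   has full column rank and every argument of [invmx] is invertible. *)
Definition block_lanczos (R : realType) (n m : nat)
    (A : 'M[R]_n) (v0 : 'M[R]_(n, m))
    (v : nat -> 'M[R]_(n, m)) (alpha beta : nat -> 'M[R]_m) : Prop :=
  [/\ v 0%N = 0,
      (v 1%N, beta 1%N) = qr v0
    & forall k : nat, (1 <= k)%N ->
        let w := A *m v k - v k.-1 *m (beta k)^T in
        alpha k = (v k)^T *m w /\
        (v k.+1, beta k.+1) = qr (w - v k *m alpha k)].

Definition dr_bcg (R : realType) (n m : nat)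
    (A : 'M[R]_n) (b x0 : 'M[R]_(n, m))
    (x w s : nat -> 'M[R]_(n, m)) (sigma xi zeta : nat -> 'M[R]_m) : Prop :=
  [/\ x 0%N = x0,
      (w 0%N, sigma 0%N) = qr (b - A *m x0),
      s 0%N = w 0%N
    & forall k : nat, (1 <= k)%N ->
        [/\ xi k.-1 = invmx ((s k.-1)^T *m A *m s k.-1),
            x k = x k.-1 + s k.-1 *m xi k.-1 *m sigma k.-1,
            (w k, zeta k) = qr (w k.-1 - A *m s k.-1 *m xi k.-1),
            s k = w k + s k.-1 *m (zeta k)^T
          & sigma k = zeta k *m sigma k.-1]].

(* Ordinals start at 0 whereas the coefficients start at 1: block (i, j) of the
   matrices below is the one in block row i + 1 and block column j + 1. *)
Definition block_T (R : realType) (m k : nat) (alpha beta : nat -> 'M[R]_m) :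
    'M[R]_(\sum_(i < k) m) :=
  \mxblock_(i < k, j < k)
    (if i == j then alpha i.+1
     else if i == j.+1 :> nat then beta i.+1
     else if j == i.+1 :> nat then (beta j.+1)^T
     else 0).

Definition block_L (R : realType) (m k : nat) (ell : nat -> 'M[R]_m) :
    'M[R]_(\sum_(i < k) m) :=
  \mxblock_(i < k, j < k)
    (if i == j then 1%:M else if i == j.+1 :> nat then ell j.+1 else 0).

Definition block_D (R : realType) (m k : nat) (d : nat -> 'M[R]_m) :
    'M[R]_(\sum_(i < k) m) :=
  \mxdiag_(i < k) d i.+1.

Definition block_LDLT (R : realType) (m k : nat)
    (alpha beta ell d : nat -> 'M[R]_m) : Prop :=
  block_T k alpha beta = block_L k ell *m block_D k d *m (block_L k ell)^T.

(* Main.v *)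
(* With M_j = s_j^T A s_j, DR-BCG gives A s_j = (w_j - w_{j+1} zeta_{j+1}) M_j.
   Eliminating s_j from s_j = w_j + s_{j-1} zeta_j^T yields a three-term
   recurrence for the w_j; multiplied by the orthogonal matrices theta_j it
   becomes, up to signs, the Lanczos recurrence with upper triangular
   off-diagonal coefficients, so by uniqueness of the QR factorization
   (-1)^j w_j theta_j = v_{j+1}. Only the orthogonality of consecutive blocks is
   needed, and full rank of all blocks follows from
   K_{j+1} <= K_j + span(block), as each Krylov block has to raise the dimension
   by m. *)

Require Import Defs.
From mathcomp Require Import all_boot all_order all_algebra.
From mathcomp Require Import boolp classical_sets reals.

Set Implicit Arguments.
Unset Strict Implicit.
Unset Printing Implicit Defensive.

Import Order.TTheory GRing.Theory Num.Theory.

Local Open Scope ring_scope.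

(** * Existence and uniqueness of the QR factorization *)

Lemma row_fullM (F : fieldType) (n m p : nat) (B : 'M[F]_(n, m)) (C : 'M_(m, p)) :
  row_full B -> row_full C -> row_full (B *m C).
Proof.
move=> /row_fullP[B' B'B] /row_fullP[C' C'C]; apply/row_fullP.
by exists (C' *m B'); rewrite -mulmxA (mulmxA B') B'B mul1mx.
Qed.

Lemma dotmx_ge0 (R : realDomainType) (n : nat) (x : 'cV[R]_n) : 0 <= (x^T *m x) 0 0.
Proof. by rewrite mxE sumr_ge0 // => i _; rewrite mxE -expr2 sqr_ge0. Qed.

Lemma dotmx_gt0 (R : realDomainType) (n : nat) (x : 'cV[R]_n) :
  (0 < (x^T *m x) 0 0) = (x != 0).
Proof.
rewrite lt0r dotmx_ge0 andbT mxE; congr negb.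
apply/eqP/eqP => [x0 | ->]; last by rewrite big1 // => i _; rewrite !mxE mul0r.
apply/matrixP=> i j; rewrite ord1 [RHS]mxE; apply/eqP.
suff: (x^T 0 i * x i 0) == 0 by rewrite mxE mulf_eq0 orbb.
by apply/eqP/(psumr_eq0P _ x0) => // l _; rewrite mxE -expr2 sqr_ge0.
Qed.

Lemma upper_triangular_unit (R : realFieldType) (m : nat) (U : 'M[R]_m) :
  (forall i j : 'I_m, (j < i)%N -> U i j = 0) -> (forall i, 0 < U i i) ->
  U \in unitmx.
Proof.
move=> U0 Upos; rewrite -unitmx_tr unitmxE unitfE det_trig.
  by apply/prodf_neq0 => i _; rewrite mxE gt_eqF.
by apply/is_trig_mxP => i j ij; rewrite mxE U0.
Qed.

Lemma is_qr_unit (R : realType) (n m : nat) (B Q : 'M[R]_(n, m)) (U : 'M[R]_m) :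
  is_qr B Q U -> U \in unitmx.
Proof. by case=> _ _ /upper_triangular_unit; apply. Qed.

Lemma orthonormal_full (F : fieldType) (n m : nat) (Q : 'M[F]_(n, m)) :
  Q^T *m Q = 1%:M -> row_full Q.
Proof. by move=> QQ; apply/row_fullP; exists Q^T. Qed.

Lemma is_qr_full (R : realType) (n m : nat) (B Q : 'M[R]_(n, m)) (U : 'M[R]_m) :
  is_qr B Q U -> row_full B.
Proof.
move=> BQU; have U1 := is_qr_unit BQU; case: BQU => -> /orthonormal_full Q1 _ _.
by apply: row_fullM => //; rewrite row_full_unit.
Qed.

(** One Gram-Schmidt step in block form: the first column fixes [a] and [q], projection onto it
    fixes [c], and a factorization with one column fewer remains. Existence and uniqueness both
    induct through this equivalence. *)
Lemma is_qr_row_mx (R : realType) (n m : nat) (b q : 'cV[R]_n) (C Q : 'M_(n, m))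
    (a : R) (c : 'rV_m) (U : 'M_m) :
  is_qr (row_mx b C) (row_mx q Q) (block_mx a%:M c 0 U) <->
  [/\ b = a *: q, q^T *m q = 1%:M, 0 < a, q^T *m Q = 0 & is_qr (C - q *m c) Q U].
Proof.
split=> [[]|[-> qq a_gt0 qQ [CE QQ U0 Upos]]].
  rewrite mul_row_block mulmx0 addr0 mul_mx_scalar => /eq_row_mx[bE CE].
  rewrite tr_row_mx mul_col_row scalar_mx_block => /eq_block_mx[qq qQ _ QQ] U0 Upos.
  split=> //; first by have := Upos (lshift m 0); rewrite block_mxEul mxE eqxx.
  split=> //; first by rewrite CE addrC addKr.
    move=> i j ij; have := U0 (rshift 1 i) (rshift 1 j).
    by rewrite block_mxEdr; apply.
  by move=> i; have := Upos (rshift 1 i); rewrite block_mxEdr.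
have Qq : Q^T *m q = 0 by rewrite -[LHS]trmxK trmx_mul trmxK qQ trmx0.
split.
- by rewrite mul_row_block mulmx0 addr0 mul_mx_scalar -CE addrC subrK.
- by rewrite tr_row_mx mul_col_row qq QQ qQ Qq scalar_mx_block.
- move=> i j; rewrite -(splitK i) -(splitK j).
  case: (fintype.split i) => i'; case: (fintype.split j) => j' /=; rewrite ?ord1 //= => ij.
  + by rewrite block_mxEdl mxE.
  + by rewrite block_mxEdr U0.
- move=> i; rewrite -(splitK i); case: (fintype.split i) => i' /=.
  + by rewrite block_mxEul ord1 mxE eqxx.
  + by rewrite block_mxEdr.
Qed.

Lemma is_qr_row_mx_exists (R : realType) (n m : nat) (b : 'cV[R]_n) (C : 'M_(n, m)) :
  (forall B : 'M[R]_(n, m), row_full B -> exists Q U, is_qr B Q U) ->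
  row_full (row_mx b C) -> exists Q U, is_qr (row_mx b C) Q U.
Proof.
move=> IHm BCfull.
have b_neq0 : b != 0.
  apply: contraTneq BCfull => ->; apply/negP=> /row_fullP[D].
  rewrite mul_mx_row mulmx0 => /matrixP/(_ (lshift m 0) (lshift m 0))/eqP.
  by rewrite row_mxEl !mxE eqxx eq_sym oner_eq0.
pose a := Num.sqrt ((b^T *m b) 0 0).
have a_gt0 : 0 < a by rewrite sqrtr_gt0 dotmx_gt0.
have bb : b^T *m b = (a ^+ 2)%:M.
  by rewrite sqr_sqrtr ?dotmx_ge0 // [LHS]mx11_scalar.
pose q := a^-1 *: b.
have qq : q^T *m q = 1%:M.
  rewrite /q -scalemxAr linearZ /= -scalemxAl bb !scalerA scale_scalar_mx.
  by rewrite -expr2 exprVn mulVf // expf_neq0 // gt_eqF.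
have bq : b = a *: q by rewrite scalerA mulfV ?scale1r // gt_eqF.
pose c := q^T *m C.
have C'full : row_full (C - q *m c).
  (* The deflated block is [row_mx b C] times a matrix with left inverse [row_mx 0 1%:M], so it
     inherits full column rank. *)
  have -> : C - q *m c = row_mx b C *m col_mx (- (a^-1 *: c)) 1%:M.
    by rewrite mul_row_col mulmx1 mulmxN -scalemxAr scalemxAl -/q addrC.
  apply: row_fullM => //; apply/row_fullP; exists (row_mx 0 1%:M).
  by rewrite mul_row_col mul0mx add0r mulmx1.
have [Q [U QU]] := IHm _ C'full.
exists (row_mx q Q), (block_mx a%:M c 0 U); apply/is_qr_row_mx; split=> //.
(* [Q] is the deflated block times [invmx U], so it is orthogonal to [q] as soon as that block
   is. *)
case: (QU) => C'E _ _ _; rewrite -(mulmxK (is_qr_unit QU) Q) -C'E mulmxA.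
by rewrite mulmxBr mulmxA qq mul1mx subrr mul0mx.
Qed.

Lemma is_qr_exists (R : realType) (n m : nat) (B : 'M[R]_(n, m)) :
  row_full B -> exists Q U, is_qr B Q U.
Proof.
elim: m B => [|m IHm] B Bfull.
  exists 0, 0; split; [| | by case | by case].
    by rewrite [B]thinmx0 mul0mx.
  by rewrite [LHS]thinmx0 [RHS]thinmx0.
move: Bfull; rewrite -[B](@hsubmxK _ n 1 m); exact: is_qr_row_mx_exists.
Qed.

Lemma is_qr_unique (R : realType) (n m : nat) (B Q1 Q2 : 'M[R]_(n, m))
    (U1 U2 : 'M[R]_m) :
  is_qr B Q1 U1 -> is_qr B Q2 U2 -> Q1 = Q2 /\ U1 = U2.
Proof.
elim: m B Q1 Q2 U1 U2 => [|m IHm].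
  move=> B Q1 Q2 U1 U2 _ _.
  by rewrite [Q1]thinmx0 [Q2]thinmx0 [U1]thinmx0 [U2]thinmx0.
rewrite -[m.+1]/(1 + m)%N => B Q1 Q2 U1 U2.
have block (U Q : 'M_(_, 1 + m)) : is_qr B Q U ->
    U = block_mx (ulsubmx U 0 0)%:M (ursubmx U) 0 (drsubmx U).
  case=> _ _ U0 _; rewrite -mx11_scalar -[LHS]submxK; congr block_mx.
  by apply/matrixP=> i j; rewrite !mxE U0 //= ord1.
move=> qr1 qr2; move: qr1 qr2 (block _ _ qr1) (block _ _ qr2).
rewrite -[B]hsubmxK -[Q1]hsubmxK -[Q2]hsubmxK.
move: (lsubmx _) (rsubmx _) (lsubmx _) (rsubmx _) (lsubmx _) (rsubmx _).
move=> q2 P2 q1 P1 b C.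
move: (ulsubmx _ _ _) (ursubmx _) (drsubmx _) (ulsubmx _ _ _) (ursubmx _) (drsubmx _).
move=> a2 c2 W2 a1 c1 W1 + + U1E U2E; rewrite {}U1E {}U2E.
move=> /is_qr_row_mx[bE1 qq1 a1_gt0 qP1 qr1] /is_qr_row_mx[bE2 qq2 a2_gt0 qP2 qr2].
have bb a q : b = a *: q -> q^T *m q = 1%:M -> b^T *m b = (a ^+ 2)%:M.
  move=> -> qq; rewrite -scalemxAr linearZ /= -scalemxAl qq scalerA.
  by rewrite scale_scalar_mx mulr1.
(* Both pivots have the same square, and positivity selects the root. *)
have a12 : a1 = a2.
  have := bb _ _ bE1 qq1; rewrite (bb _ _ bE2 qq2) => /matrixP/(_ 0 0)/eqP.
  by rewrite !mxE /= eqrXn2 ?ltW // => /eqP.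
have q12 : q1 = q2.
  by move: bE1; rewrite bE2 a12 => /scalerI->//; rewrite gt_eqF.
have cE c P W q : q^T *m q = 1%:M -> q^T *m P = 0 -> is_qr (C - q *m c) P W ->
    c = q^T *m C.
  move=> qq qP [/(congr1 (mulmx q^T)) + _ _ _].
  by rewrite mulmxBr !mulmxA qq qP mul0mx mul1mx => /eqP; rewrite subr_eq0 => /eqP.
have c12 : c1 = c2.
  by rewrite (cE _ _ _ _ _ qq1 qP1 qr1) (cE _ _ _ _ _ qq2 qP2 qr2) q12.
rewrite q12 c12 in qr1.
by have [-> ->] := IHm _ _ _ _ _ qr1 qr2; rewrite a12 q12 c12.
Qed.

Lemma qrP (R : realType) (n m : nat) (B : 'M[R]_(n, m)) :
  row_full B -> is_qr B (qr B).1 (qr B).2.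
Proof.
move=> /is_qr_exists[Q [U BQU]].
exact: (xgetI (P := [set QU | is_qr B QU.1 QU.2]%classic) (0, 0) (x := (Q, U))).
Qed.

Lemma qr_unique (R : realType) (n m : nat) (B Q : 'M[R]_(n, m)) (U : 'M[R]_m) :
  is_qr B Q U -> qr B = (Q, U).
Proof.
move=> BQU; have := qrP (is_qr_full BQU).
case: (qr B) => Q' U' /= BQU'.
by have [-> ->] := is_qr_unique BQU BQU'.
Qed.

Lemma eq_qrP (R : realType) (n m : nat) (B Q : 'M[R]_(n, m)) (U : 'M[R]_m) :
  (Q, U) = qr B -> row_full B -> is_qr B Q U.
Proof. by move=> QU /qrP; rewrite -QU. Qed.

(** A kernel vector [y] would make the quadratic form of [A] vanish at the nonzero vector
    [s *m y^T]. *)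
Lemma spd_unit (R : realType) (n m : nat) (A : 'M[R]_n) (s : 'M[R]_(n, m)) :
  spd A -> row_full s -> s^T *m A *m s \in unitmx.
Proof.
case=> _ Apos sfull; rewrite unitmxE unitfE; apply/negP => /det0P[y y0 yM0].
have sy0 : s *m y^T != 0.
  apply: contra y0 => /eqP sy0; rewrite -trmx_eq0; apply/eqP.
  by apply: (row_full_inj sfull); rewrite sy0 mulmx0.
rewrite !mulmxA in yM0.
by have := Apos _ sy0; rewrite trmx_mul trmxK !mulmxA yM0 mul0mx mxE ltxx.
Qed.

(** * Krylov spaces and dimension counts *)

Lemma krylovS (R : realType) (n m : nat) (A : 'M[R]_n) (r : 'M[R]_(n, m)) (j : nat) :
  (krylov A r j.+1 :=: krylov A r j + (A ^+ j *m r)^T)%MS.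
Proof.
by rewrite /krylov big_ord_recr /=; apply: adds_eqmx (eqmx_refl _) (genmxE _).
Qed.

Lemma krylov_sub (R : realType) (n m : nat) (A : 'M[R]_n) (r : 'M[R]_(n, m)) (j : nat) :
  (krylov A r j <= krylov A r j.+1)%MS.
Proof. by rewrite krylovS addsmxSl. Qed.

Lemma krylovMr (R : realType) (n m : nat) (A : 'M[R]_n) (r : 'M[R]_(n, m)) (j : nat) :
  A^T = A -> (krylov A r j *m A <= krylov A r j.+1)%MS.
Proof.
move=> AT; elim: j => [|j IHj]; first by rewrite /krylov big_ord0 mul0mx sub0mx.
rewrite (eqmxMr _ (krylovS _ _ _)) addsmxMr addsmx_sub.
rewrite (submx_trans IHj) ?krylov_sub //= -{2}AT -trmx_mul mulmxA.
by rewrite -[A *m _]/(A * A ^+ j) -exprS krylovS addsmxSr.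
Qed.

Lemma rank_krylovS (R : realType) (n m : nat) (A : 'M[R]_n) (r : 'M[R]_(n, m)) (j : nat) :
  (\rank (krylov A r j.+1) <= \rank (krylov A r j) + m)%N.
Proof.
rewrite krylovS (leq_trans (mxrank_adds_leqif _ _)) // leq_add2l.
exact: rank_leq_row.
Qed.

Lemma rank_krylov_leq (R : realType) (n m : nat) (A : 'M[R]_n) (r : 'M[R]_(n, m)) (j : nat) :
  (\rank (krylov A r j) <= j * m)%N.
Proof.
elim: j => [|j IHj]; first by rewrite /krylov big_ord0 mxrank0.
by rewrite (leq_trans (rank_krylovS _ _ _)) // mulSnr leq_add2r.
Qed.

(** Each step adds at most [m] dimensions, so a maximal count at [k] leaves no room for an earlier
    deficit. *)
Lemma rank_krylov_prefix (R : realType) (n m : nat) (A : 'M[R]_n) (r : 'M[R]_(n, m))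
    (j k : nat) :
  (j <= k)%N -> \rank (krylov A r k) = (k * m)%N -> \rank (krylov A r j) = (j * m)%N.
Proof.
elim: k => [|k IHk]; first by rewrite leqn0 => /eqP->.
rewrite leq_eqVlt => /predU1P[-> // | jk rk]; apply: IHk => //.
apply/eqP; rewrite eqn_leq rank_krylov_leq /= -(leq_add2r m) -mulSnr -rk.
exact: rank_krylovS.
Qed.

(** The step from [j] to [j.+1] gains exactly [m] dimensions and [B^T] must supply all of them. This
    yields the full rank of the initial residual, of the directions and of the QR arguments in
    DR-BCG. *)
Lemma krylov_extension_full (R : realType) (n m : nat) (A : 'M[R]_n)
    (r B : 'M[R]_(n, m)) (j k : nat) :
  (j <= k)%N -> \rank (krylov A r k.+1) = (k.+1 * m)%N ->
  (krylov A r j.+1 <= krylov A r j + B^T)%MS -> row_full B.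
Proof.
move=> jk rk /mxrankS; rewrite (rank_krylov_prefix _ rk) // => rj.
rewrite -col_leq_rank -(leq_add2l (j * m)) -mulSnr (leq_trans rj) //.
by rewrite (leq_trans (mxrank_adds_leqif _ _)) // mxrank_tr leq_add2r rank_krylov_leq.
Qed.

Lemma krylov_extensionS (R : realType) (n m : nat) (A : 'M[R]_n)
    (r B : 'M[R]_(n, m)) (j : nat) :
  A^T = A -> (krylov A r j.+1 <= krylov A r j + B^T)%MS ->
  (krylov A r j.+2 <= krylov A r j.+1 + (A *m B)^T)%MS.
Proof.
move=> AT KB; rewrite krylovS addsmx_sub addsmxSl exprS -[A * _]/(A *m _).
rewrite -mulmxA !trmx_mul AT /=.
have: ((A ^+ j *m r)^T <= krylov A r j + B^T)%MS.
  by apply: submx_trans KB; rewrite krylovS addsmxSr.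
move=> /(submxMr A) /submx_trans; rewrite trmx_mul; apply.
by rewrite addsmxMr addsmxS ?krylovMr.
Qed.

(** Exchange rule: modulo [Y] the columns of [B] are combinations of those of [C], so [C] can
    replace [B] as the block extending [Y]. *)
Lemma adds_trmx_exchange (F : fieldType) (n m : nat) (X Y : 'M[F]_n)
    (B C W : 'M[F]_(n, m)) (E : 'M[F]_m) :
  B = C *m E + W -> (W^T <= Y)%MS -> (X <= Y + B^T)%MS -> (X <= Y + C^T)%MS.
Proof.
move=> -> WY /submx_trans; apply; rewrite addsmx_sub addsmxSl linearD /= trmx_mul.
rewrite addmx_sub ?(submx_trans WY) ?addsmxSl //.
by rewrite (submx_trans (submxMl _ _)) ?addsmxSr.
Qed.

(** * Full rank and local orthogonality along DR-BCG *)

(* Orthogonality is only recorded locally: the last equation is the A-orthogonality of [s] and the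
   previous direction, since [w] and [s] differ by a multiple of the latter. *)
Definition dr_bcg_state (R : realType) (n m : nat) (A : 'M[R]_n) (r : 'M[R]_(n, m))
    (j : nat) (w s : 'M[R]_(n, m)) : Prop :=
  [/\ w^T *m w = 1%:M,
      (krylov A r j.+1 <= krylov A r j + s^T)%MS,
      (w^T <= krylov A r j.+1)%MS,
      (s^T <= krylov A r j.+1)%MS
    & w^T *m A *m s = s^T *m A *m s].

Lemma dr_bcg_state0 (R : realType) (n m : nat) (A : 'M[R]_n) (r w : 'M[R]_(n, m))
    (sigma : 'M[R]_m) :
  is_qr r w sigma -> dr_bcg_state A r 0 w w.
Proof.
move=> rw; have su := is_qr_unit rw; case: rw => rE ww _ _.
have wr : (w^T <= krylov A r 1)%MS.
  have -> : w^T = (invmx sigma)^T *m r^T by rewrite -trmx_mul rE mulmxK.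
  by rewrite krylovS expr0 mul1mx (submx_trans (submxMl _ _)) ?addsmxSr.
split=> //; rewrite krylovS expr0 mul1mx addsmx_sub addsmxSl /=.
have -> : r^T = sigma^T *m w^T by rewrite -trmx_mul -rE.
by rewrite (submx_trans (submxMl _ _)) ?addsmxSr.
Qed.

(** The extending block is exchanged from [s] to [A *m s], to [u], to [w'] and to the new direction;
    full rank of [s] and [u] justifies inverting [M] and factoring [u]. *)
Lemma dr_bcg_stateS (R : realType) (n m k j : nat) (A : 'M[R]_n)
    (r w s w' : 'M[R]_(n, m)) (zeta : 'M[R]_m) :
  let M := s^T *m A *m s in
  let u := w - A *m s *m invmx M in
  spd A -> (j < k)%N -> \rank (krylov A r k.+1) = (k.+1 * m)%N ->
  dr_bcg_state A r j w s -> (w', zeta) = qr u ->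
  [/\ M \in unitmx, is_qr u w' zeta, w^T *m w' = 0
    & dr_bcg_state A r j.+1 w' (w' + s *m zeta^T)].
Proof.
move=> M u Aspd jk rk [ww Ks wK sK wAs] qru; have [AT _] := Aspd.
have Mu : M \in unitmx.
  by apply: spd_unit => //; apply: krylov_extension_full rk Ks; apply: ltnW.
have MT : M^T = M by rewrite /M !trmx_mul trmxK AT mulmxA.
have As : A *m s = (w - u) *m M by rewrite opprB addrC subrK mulmxKV.
have Ku : (krylov A r j.+2 <= krylov A r j.+1 + u^T)%MS.
  apply: adds_trmx_exchange (krylov_extensionS AT Ks).
    by rewrite As mulmxBl addrC -mulmxN.
  by rewrite trmx_mul (submx_trans (submxMl _ _)).
have qu := eq_qrP qru (krylov_extension_full jk rk Ku).
have zu := is_qr_unit qu.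
have [uE w'w' _ _] := qu.
have uw' : w' = u *m invmx zeta by rewrite uE mulmxK.
(* By the last state equation [w^T *m A *m s] equals [M], so [w^T *m u] is [1%:M - M *m invmx M],
   which vanishes. *)
have ww' : w^T *m w' = 0.
  by rewrite uw' mulmxA mulmxBr ww !mulmxA wAs mulmxV // subrr mul0mx.
have sAw' : s^T *m A *m w' = - (M *m zeta^T).
  rewrite -[s^T *m A]trmxK trmx_mul trmxK AT As trmx_mul linearB /= MT -mulmxA.
  by rewrite mulmxBl ww' sub0r uE trmx_mul -[_ *m w'^T *m w']mulmxA w'w' mulmx1 mulmxN.
have w'K : (w'^T <= krylov A r j.+2)%MS.
  rewrite uw' trmx_mul (submx_trans (submxMl _ _)) // /u linearB addmx_sub //=.
    by rewrite (submx_trans wK) ?krylov_sub.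
  rewrite eqmx_opp trmx_mul (submx_trans (submxMl _ _)) // trmx_mul AT.
  exact: submx_trans (submxMr A sK) (krylovMr _ _ AT).
have szK : ((s *m zeta^T)^T <= krylov A r j.+1)%MS.
  by rewrite trmx_mul (submx_trans (submxMl _ _)).
split=> //; split=> //.
- apply: (@adds_trmx_exchange _ _ _ _ _ w' _ (- (s *m zeta^T)) 1%:M).
  + by rewrite mulmx1 addrK.
  + by rewrite linearN /= eqmx_opp.
  apply: (@adds_trmx_exchange _ _ _ _ _ u w' 0 zeta) Ku; first by rewrite addr0.
  by rewrite trmx0 sub0mx.
- by rewrite linearD /= addmx_sub // (submx_trans szK) ?krylov_sub.
(* Conjugacy of consecutive directions: it removes the [s] part of the new direction from the last
   state equation. *)
have sAs' : s^T *m A *m (w' + s *m zeta^T) = 0.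
  by rewrite mulmxDr sAw' mulmxA addNr.
have -> : (w' + s *m zeta^T)^T = w'^T + zeta *m s^T.
  by rewrite linearD /= trmx_mul trmxK.
by rewrite !mulmxDl -[zeta *m _ *m A]mulmxA -(mulmxA zeta) sAs' mulmx0 addr0.
Qed.

Lemma dr_bcg_regular (R : realType) (n m k : nat) (A : 'M[R]_n)
    (b x0 : 'M[R]_(n, m)) (x w s : nat -> 'M[R]_(n, m)) (sigma xi zeta : nat -> 'M[R]_m) :
  spd A -> \rank (krylov A (b - A *m x0) k.+1) = (k.+1 * m)%N ->
  dr_bcg A b x0 x w s sigma xi zeta ->
  is_qr (b - A *m x0) (w 0%N) (sigma 0%N) /\
  (forall j, (j < k)%N ->
    [/\ (s j)^T *m A *m s j \in unitmx,
        is_qr (w j - A *m s j *m xi j) (w j.+1) (zeta j.+1),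
        (w j)^T *m w j.+1 = 0 & (w j)^T *m w j = 1%:M]).
Proof.
move=> Aspd rk [_ w0E s0E step].
have rfull : row_full (b - A *m x0).
  by apply: (krylov_extension_full (leq0n k) rk); rewrite krylovS expr0 mul1mx.
have qr0 := eq_qrP w0E rfull; split=> //.
have state j : (j <= k)%N -> dr_bcg_state A (b - A *m x0) j (w j) (s j).
  elim: j => [|j IHj] jk; first by rewrite s0E; apply: dr_bcg_state0 qr0.
  have [/= xiE _ wE -> _] := step j.+1 isT; rewrite xiE in wE.
  by have [] := dr_bcg_stateS Aspd jk rk (IHj (ltnW jk)) wE.
move=> j jk; have jw := state j (ltnW jk).
have [/= xiE _ wE _ _] := step j.+1 isT; rewrite xiE in wE *.
by have [? ? ? _] := dr_bcg_stateS Aspd jk rk jw wE; split=> //; case: jw.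
Qed.

(** * Blockwise form of the LDL^T factorization *)

(** A bidiagonal [L] makes the product tridiagonal, so only diagonal and adjacent blocks carry
    information. The two off-diagonal equations stay separate because [d] may be nonsymmetric
    here. *)
Lemma block_LDLT_entries (R : realType) (m K : nat) (alpha beta ell d : nat -> 'M[R]_m) :
  block_LDLT K alpha beta ell d <->
  forall j, (j < K)%N ->
    alpha j.+1 = d j.+1 + (if j is 0 then 0 else ell j *m d j *m (ell j)^T) /\
    ((j.+1 < K)%N ->
      beta j.+2 = ell j.+1 *m d j.+1 /\ (beta j.+2)^T = d j.+1 *m (ell j.+1)^T).
Proof.
pose L (i l : nat) : 'M_m := if i == l then 1%:M else if i == l.+1 then ell l.+1 else 0.
pose T (i j : nat) : 'M_m := if i == j then alpha i.+1
  else if i == j.+1 then beta i.+1 else if j == i.+1 then (beta j.+1)^T else 0.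
have n1 i : (i == i.+1) = false by rewrite ltn_eqF.
have n2 i : (i == i.+2) = false by rewrite ltn_eqF // leqnSn.
have L1 i : L i i = 1%:M by rewrite /L eqxx.
have LS i : L i.+1 i = ell i.+1 by rewrite /L eqxx eq_sym n1.
have L0 i l : (l != i) -> (i != l.+1) -> L i l = 0.
  by rewrite /L eq_sym => /negPf-> /negPf->.
have TD j : T j j = alpha j.+1 by rewrite /T eqxx.
have TU j : T j j.+1 = (beta j.+2)^T by rewrite /T n1 n2 eqxx.
have TL j : T j.+1 j = beta j.+2 by rewrite /T eq_sym n1 eqxx.
(* Block [(i, j)] of the product: row [i] of [L] has at most the two nonzero blocks [1%:M] and
   [ell i], so the sum collapses to these terms. *)
pose P i j := d i.+1 *m (L j i)^T +
  (if i is i'.+1 then ell i *m (d i *m (L j i')^T) else 0).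
have PE i j : (i < K)%N -> P i j = \sum_(l < K) L i l *m d l.+1 *m (L j l)^T.
  move=> iK; rewrite (bigD1 (Ordinal iK)) //= L1 mul1mx; congr (_ + _).
  case: i iK => [|i] iK.
    apply/esym/big1 => l l0; rewrite L0 ?mul0mx //; exact: l0.
  rewrite (bigD1 (Ordinal (ltnW iK))) -?val_eqE /= ?n1 // LS mulmxA.
  rewrite big1 ?addr0 // => l /andP[li li']; rewrite L0 ?mul0mx //.
  by rewrite eqSS eq_sym; exact: li'.
have LDLT_P : block_LDLT K alpha beta ell d <-> forall i j : 'I_K, T i j = P i j.
  rewrite /block_LDLT /block_T /block_L /block_D mul_mxblock_mxdiag tr_mxblock mul_mxblock.
  split=> [/eq_mxblockP TP i j | TP]; first by rewrite PE // -[RHS]TP.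
  by apply: eq_mxblock => i j; rewrite -[LHS]/(T i j) TP PE.
have Pdiag j : P j j = d j.+1 + (if j is 0 then 0 else ell j *m d j *m (ell j)^T).
  by rewrite /P L1 trmx1 mulmx1; case: j => // j; rewrite LS mulmxA.
have Pup j : P j j.+1 = d j.+1 *m (ell j.+1)^T.
  rewrite /P LS; case: j => [|j]; first by rewrite addr0.
  by rewrite L0 ?trmx0 ?mulmx0 ?addr0 // ?n2 // eqSS eq_sym n1.
have Plow j : P j.+1 j = ell j.+1 *m d j.+1.
  by rewrite /P L1 trmx1 mulmx1 L0 ?trmx0 ?mulmx0 ?add0r // ?n2 // eq_sym n1.
have Lfar i l : (i < l)%N || (l.+1 < i)%N -> L i l = 0.
  case/orP=> il; apply: L0.
  - by rewrite gtn_eqF.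
  - by rewrite ltn_eqF // leqW.
  - by rewrite ltn_eqF // ltnW.
  - by rewrite gtn_eqF.
have Pfar i j : (i.+1 < j)%N || (j.+1 < i)%N -> P i j = 0.
  move=> far; rewrite /P Lfar; last by case/orP: far => [->|/ltnW->]; rewrite ?orbT.
  rewrite trmx0 mulmx0 add0r; case: i far => // i far.
  rewrite Lfar ?trmx0 ?mulmx0 //.
  by move: far; rewrite ltnS => /orP[/ltnW->|->]; rewrite ?orbT.
rewrite LDLT_P; split=> [TP j jK | TP i j].
  split; first by rewrite -Pdiag -TD; apply: TP (Ordinal jK) (Ordinal jK).
  move=> jK1; rewrite -Pup -Plow -TU -TL; split.
    exact: TP (Ordinal jK1) (Ordinal jK).
  exact: TP (Ordinal jK) (Ordinal jK1).
have [ij|ji|ij] := ltngtP i j; last first.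
- by rewrite -ij Pdiag TD; have [] := TP i (ltn_ord i).
- move: (ji); rewrite leq_eqVlt => /predU1P[E|ji1].
    by have [_] := TP j (ltn_ord j); rewrite -E Plow TL => -[|//]; rewrite E.
  by rewrite Pfar ?ji1 ?orbT // /T (gtn_eqF ji) (gtn_eqF ji1) (ltn_eqF (leqW ji)).
- move: (ij); rewrite leq_eqVlt => /predU1P[E|ij1].
    by have [_] := TP i (ltn_ord i); rewrite -E Pup TU => -[|//]; rewrite E.
  by rewrite Pfar ?ij1 // /T (ltn_eqF ij) (ltn_eqF (leqW ij)) (gtn_eqF ij1).
Qed.

(** * From the DR-BCG recurrence to the Lanczos recurrence *)

(* QR uniqueness makes the Lanczos blocks and coefficients the only solution of
   the three-term recurrence with consecutively orthonormal blocks. *)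
Lemma block_lanczos_unique (R : realType) (n m k : nat) (A : 'M[R]_n)
    (r : 'M[R]_(n, m)) (v q : nat -> 'M[R]_(n, m)) (alpha beta a b : nat -> 'M[R]_m) :
  block_lanczos A r v alpha beta ->
  q 0%N = 0 -> is_qr r (q 1%N) (b 1%N) ->
  (forall j, (j < k)%N ->
    [/\ is_qr (q j.+2 *m b j.+2) (q j.+2) (b j.+2),
        (q j.+1)^T *m q j.+1 = 1%:M, (q j.+1)^T *m q j.+2 = 0
      & A *m q j.+1 = q j.+2 *m b j.+2 + q j.+1 *m a j.+1 + q j *m (b j.+1)^T]) ->
  (forall j, (j <= k)%N -> v j = q j /\ v j.+1 = q j.+1 /\ beta j.+1 = b j.+1) /\
  (forall j, (j < k)%N -> alpha j.+1 = a j.+1 /\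
    row_full (A *m v j.+1 - v j *m (beta j.+1)^T - v j.+1 *m alpha j.+1)).
Proof.
move=> [v0 v1 step] q0 qr1 rec.
have Lj j : (j < k)%N -> v j = q j -> v j.+1 = q j.+1 -> beta j.+1 = b j.+1 ->
  [/\ alpha j.+1 = a j.+1, v j.+2 = q j.+2, beta j.+2 = b j.+2 &
    row_full (A *m v j.+1 - v j *m (beta j.+1)^T - v j.+1 *m alpha j.+1)].
  move=> jk vq vq1 bb; have [/= aE] := step j.+1 isT.
  have [qr2 qq qq' Aq] := rec j jk.
  have E : A *m v j.+1 - v j *m (beta j.+1)^T = q j.+2 *m b j.+2 + q j.+1 *m a j.+1.
    by rewrite vq vq1 bb Aq addrK.
  (* Multiplication by the transpose of [q j.+1] kills the next block and isolates [a j.+1]. *)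
  have aa : alpha j.+1 = a j.+1.
    by rewrite aE E vq1 mulmxDr !mulmxA qq qq' mul0mx mul1mx add0r.
  rewrite E aa vq1 addrK (qr_unique qr2) => -[-> ->]; split=> //.
  exact: is_qr_full qr2.
have vqb j : (j <= k)%N -> v j = q j /\ v j.+1 = q j.+1 /\ beta j.+1 = b j.+1.
  elim: j => [_|j IHj jk].
    by move: v1; rewrite (qr_unique qr1) v0 q0 => -[-> ->].
  have [vq [vq1 bb]] := IHj (ltnW jk).
  by have [] := Lj j jk vq vq1 bb.
split=> // j jk; have [vq [vq1 bb]] := vqb j (ltnW jk).
by have [] := Lj j jk vq vq1 bb.
Qed.

(** Transfers a triangular factor found in a small QR factorization of size [m] to the tall Lanczos
    residual. *)
Lemma is_qr_mul (R : realType) (n p m : nat) (B P : 'M[R]_(n, m)) (Q : 'M[R]_(p, m))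
    (U : 'M[R]_m) :
  is_qr B P U -> Q^T *m Q = 1%:M -> is_qr (Q *m U) Q U.
Proof. by case=> _ _ U0 Upos QQ; split. Qed.

(* Eliminating the directions [s] from DR-BCG; the LDL^T coefficients appear
   after multiplication by the orthogonal matrix [theta1]. *)
Lemma dr_bcg_three_term (R : realType) (n m : nat) (A : 'M[R]_n)
    (w0 w1 w2 s0 s1 : 'M[R]_(n, m))
    (M0 M1 zeta1 zeta2 theta0 theta1 theta2 beta1 beta2 : 'M[R]_m) :
  M0^T = M0 -> theta0^T *m theta0 = 1%:M -> theta1^T *m theta1 = 1%:M ->
  A *m s0 = (w0 - w1 *m zeta1) *m M0 ->
  A *m s1 = (w1 - w2 *m zeta2) *m M1 ->
  s1 = w1 + s0 *m zeta1^T ->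
  zeta1 *m (M0 *m theta0) = theta1 *m beta1 ->
  zeta2 *m (M1 *m theta1) = theta2 *m beta2 ->
  A *m (w1 *m theta1) = - (w2 *m theta2 *m beta2) +
    w1 *m theta1 *m (theta1^T *m (M1 *m theta1) + theta1^T *m zeta1 *m theta0 *m beta1^T)
    - w0 *m theta0 *m beta1^T.
Proof.
move=> M0T o0 o1 As0 As1 s1E z1 z2.
(* Symmetry of [M0] lets the coefficient left on [w0] by the elimination be written with the
   transpose of [beta1]. *)
have b1 : theta0 *m beta1^T = M0 *m zeta1^T *m theta1.
  have -> : beta1 = theta1^T *m zeta1 *m M0 *m theta0.
    by rewrite -!mulmxA z1 mulmxA o1 mul1mx.
  by rewrite !trmx_mul trmxK M0T !mulmxA (mulmx1C o0) mul1mx.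
rewrite mulmxDr !mulmxA -[w1 *m theta1 *m theta1^T]mulmxA (mulmx1C o1) mulmx1.
rewrite -!(mulmxA _ theta0) b1 -[w2 *m theta2 *m _]mulmxA -z2.
have -> : A *m w1 = A *m s1 - A *m s0 *m zeta1^T.
  by rewrite s1E mulmxDr mulmxA addrK.
rewrite As1 As0 !mulmxBl !mulmxA opprB addrA; congr (_ - _).
by rewrite addrAC (addrC (w1 *m _ *m _)) addrA -[RHS]addrA [in RHS]addrC.
Qed.

(** Orthogonality and invertibility alternate: an orthogonal [theta j] makes the next QR argument
    invertible, and the orthonormal factor of that argument is [theta j.+1]. *)
Lemma theta_regular (R : realType) (m k : nat) (M zeta tau theta beta : nat -> 'M[R]_m) :
  theta 0%N = 1%:M ->
  (forall j, (j < k)%N ->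
    [/\ M j \in unitmx, zeta j.+1 \in unitmx, tau j.+1 = M j *m theta j
      & (theta j.+1, beta j.+2) = qr (zeta j.+1 *m tau j.+1)]) ->
  (forall j, (j <= k)%N -> (theta j)^T *m theta j = 1%:M) /\
  (forall j, (j < k)%N ->
    is_qr (zeta j.+1 *m tau j.+1) (theta j.+1) (beta j.+2)).
Proof.
move=> th0 step.
have qr_th j : (j < k)%N -> (theta j)^T *m theta j = 1%:M ->
    is_qr (zeta j.+1 *m tau j.+1) (theta j.+1) (beta j.+2).
  move=> jk /mulmx1_unit[_ thu]; have [Mu zu tauE] := step j jk.
  by move/eq_qrP; apply; rewrite row_full_unit tauE !unitmx_mul zu Mu.
have orth j : (j <= k)%N -> (theta j)^T *m theta j = 1%:M.
  elim: j => [|j IHj] jk; first by rewrite th0 trmx1 mulmx1.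
  by have [] := qr_th j jk (IHj (ltnW jk)).
by split=> // j jk; apply: qr_th (orth j (ltnW jk)).
Qed.

(** * Identification of the coefficients, the factors and the Lanczos block *)

Theorem theorem3 (R : realType) (n m k : nat)
  (A : 'M[R]_n) (b x0 : 'M[R]_(n, m))
  (v : nat -> 'M[R]_(n, m)) (alpha beta : nat -> 'M[R]_m)
  (x w s : nat -> 'M[R]_(n, m)) (sigma xi zeta : nat -> 'M[R]_m)
  (tau d alpha' theta beta' ell : nat -> 'M[R]_m) :
  spd A ->
  (1 <= k)%N ->
  \rank (krylov A (b - A *m x0) k.+1) = (k.+1 * m)%N ->
  block_lanczos A (b - A *m x0) v alpha beta ->
  dr_bcg A b x0 x w s sigma xi zeta ->
  (* the recurrences *)
  beta' 1%N = sigma 0%N -> theta 0%N = 1%:M -> ell 0%N = 0 ->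
  (forall j : nat, (1 <= j <= k)%N ->
    [/\ tau j = invmx (xi j.-1) *m theta j.-1,
        d j = (theta j.-1)^T *m tau j,
        alpha' j = d j + ell j.-1 *m (beta' j)^T,
        (theta j, beta' j.+1) = qr (zeta j *m tau j)
      & ell j = (theta j)^T *m zeta j *m theta j.-1]) ->
  [/\ (* everything involved is well defined *)
      row_full (b - A *m x0) /\
      (forall j : nat, (1 <= j <= k)%N ->
        [/\ row_full (A *m v j - v j.-1 *m (beta j)^T - v j *m alpha j),
            (s j.-1)^T *m A *m s j.-1 \in unitmx,
            row_full (w j.-1 - A *m s j.-1 *m xi j.-1),
            row_full (zeta j *m tau j)
          & theta j \in unitmx]),
      (* the block Lanczos coefficients *)
      (forall j : nat, (1 <= j <= k)%N ->
        alpha' j = alpha j /\ beta' j.+1 = beta j.+1),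
      (* the factors of T_k and, for ell_k, of T_(k+1) *)
      block_LDLT k alpha beta ell d /\
      (exists d1 : nat -> 'M[R]_m,
        (forall j : nat, (1 <= j <= k)%N -> d1 j = d j) /\
        block_LDLT k.+1 alpha beta ell d1),
      (* these factorizations are unique *)
      (forall (K : nat) (ell1 d1 : nat -> 'M[R]_m), (k <= K <= k.+1)%N ->
        block_LDLT K alpha beta ell1 d1 ->
        (forall j : nat, (1 <= j <= k)%N -> d1 j = d j) /\
        (forall j : nat, (1 <= j < K)%N -> ell1 j = ell j))
      (* the Lanczos block *)
    & v k.+1 = (-1) ^+ k *: (w k *m (invmx (theta k))^T)].
Proof.
move=> Aspd k_gt0 rk lanczos dr beta1 th0 ell0 rec.
have [AT _] := Aspd; have [qr_r0 reg] := dr_bcg_regular Aspd rk dr.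
have [_ _ s0E drstep] := dr.
have [M ME] : exists M, forall j, M j = (s j)^T *m A *m s j.
  by exists (fun j => (s j)^T *m A *m s j).
have MT j : (M j)^T = M j by rewrite ME !trmx_mul trmxK AT mulmxA.
(* Valid for every [j]: [invmx] leaves singular matrices fixed, hence is an involution. *)
have xiE j : invmx (xi j) = M j by have [/= -> _ _ _ _] := drstep j.+1 isT; rewrite ME invmxK.
have Mu j : (j < k)%N -> M j \in unitmx by move=> /reg[? _ _ _]; rewrite ME.
have [th_orth qr_th] : (forall j, (j <= k)%N -> (theta j)^T *m theta j = 1%:M) /\
    (forall j, (j < k)%N ->
      is_qr (zeta j.+1 *m tau j.+1) (theta j.+1) (beta' j.+2)).
  apply: (@theta_regular _ _ _ M) => // j jk; have [_ qr_w _ _] := reg j jk.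
  have [/= tauE _ _ thE _] := rec j.+1 jk.
  by split; rewrite ?Mu ?(is_qr_unit qr_w) ?tauE ?xiE // thE tauE xiE.
have th_unit j : (j <= k)%N -> theta j \in unitmx.
  by move=> /th_orth/mulmx1_unit[].
have tauE j : (j < k)%N -> tau j.+1 = M j *m theta j.
  by move=> jk; have [/= -> _ _ _ _] := rec j.+1 jk; rewrite xiE.
have dE j : (j < k)%N -> d j.+1 = (theta j)^T *m (M j *m theta j).
  by move=> jk; have [/= _ -> _ _ _] := rec j.+1 jk; rewrite tauE.
have dT j : (j < k)%N -> (d j.+1)^T = d j.+1.
  by move=> jk; rewrite dE // !trmx_mul trmxK MT mulmxA.
have du j : (j < k)%N -> d j.+1 \in unitmx.
  by move=> jk; rewrite dE // !unitmx_mul unitmx_tr Mu ?th_unit // ltnW.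
have aE j : (j < k)%N -> alpha' j.+1 = d j.+1 + ell j *m (beta' j.+1)^T.
  by move=> jk; have [] := rec j.+1 jk.
have ellE j : (j < k)%N -> ell j.+1 = (theta j.+1)^T *m zeta j.+1 *m theta j.
  by move=> jk; have [] := rec j.+1 jk.
have zE j : (j < k)%N -> zeta j.+1 *m (M j *m theta j) = theta j.+1 *m beta' j.+2.
  by move=> jk; rewrite -tauE //; have [] := qr_th j jk.
(* In [ell j.+1 *m d j.+1] the inner factor [theta j] cancels against its transpose, leaving the
   transpose of [theta j.+1] times the QR argument. *)
have ld j : (j < k)%N -> beta' j.+2 = ell j.+1 *m d j.+1.
  move=> jk; rewrite ellE // dE // -!mulmxA [theta j *m _]mulmxA.
  by rewrite (mulmx1C (th_orth j (ltnW jk))) mul1mx zE // mulmxA th_orth // mul1mx.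
have dl j : (j < k)%N -> (beta' j.+2)^T = d j.+1 *m (ell j.+1)^T.
  by move=> jk; rewrite ld // trmx_mul dT.
have w_orth j : (j <= k)%N -> (w j)^T *m w j = 1%:M.
  case: j => [|j] jk; first by case: qr_r0.
  by have [_ [_ ? _ _] _ _] := reg j jk.
have As j : (j < k)%N -> A *m s j = (w j - w j.+1 *m zeta j.+1) *m M j.
  move=> jk; have [_ [<- _ _ _] _ _] := reg j jk.
  by rewrite opprB addrC subrK -mulmxA -xiE mulmxV ?mulmx1 // -unitmx_inv xiE Mu.
(* Candidate Lanczos blocks, shifted by one against [w], with the zero start block at index 0. The
   alternating sign makes the neighbour terms of the three-term recurrence positive. *)
pose q j := if j is i.+1 then (-1) ^+ i *: (w i *m theta i) else 0.
have qq i j : (q i.+1)^T *m q j.+1 =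
    ((-1) ^+ i * (-1) ^+ j) *: ((theta i)^T *m ((w i)^T *m w j) *m theta j).
  by rewrite /q -scalemxAr linearZ /= -scalemxAl scalerA mulrC trmx_mul !mulmxA.
have q_orth j : (j <= k)%N -> (q j.+1)^T *m q j.+1 = 1%:M.
  by move=> jk; rewrite qq w_orth // mulmx1 th_orth // -expr2 sqrr_sign scale1r.
have three_term j : (j < k)%N ->
    A *m q j.+1 = q j.+2 *m beta' j.+2 + q j.+1 *m alpha' j.+1 + q j *m (beta' j.+1)^T.
  move=> jk; rewrite aE //; case: j jk => [|j] jk.
    (* There is no previous direction in the first step: [s 0] is [w 0], while [q 0] and [ell 0]
       vanish. *)
    rewrite /q mul0mx addr0 ell0 mul0mx addr0 expr1 expr0 scale1r scaleN1r dE // th0.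
    rewrite !mulmx1 trmx1 mul1mx -s0E As // s0E mulNmx -mulmxA -zE // th0 mulmx1.
    by rewrite mulmxBl mulmxA addrC.
  have j1k := ltnW jk.
  have sE : s j.+1 = w j.+1 + s j *m (zeta j.+1)^T by have [] := drstep j.+1 isT.
  have := dr_bcg_three_term (MT j) (th_orth j (ltnW j1k)) (th_orth j.+1 j1k)
    (As j j1k) (As j.+1 jk) sE (zE j j1k) (zE j.+1 jk).
  rewrite -dE // -ellE // => E.
  rewrite /q -scalemxAr E -!scalemxAl !scalerDr !scalerN !exprS !mulN1r.
  by rewrite !scaleNr !opprK.
have qr_q1 : is_qr (b - A *m x0) (q 1%N) (beta' 1%N).
  by rewrite /q beta1 expr0 scale1r th0 mulmx1.
have [vqb alphaE] : (forall j, (j <= k)%N ->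
      v j = q j /\ v j.+1 = q j.+1 /\ beta j.+1 = beta' j.+1) /\
    (forall j, (j < k)%N -> alpha j.+1 = alpha' j.+1 /\
      row_full (A *m v j.+1 - v j *m (beta j.+1)^T - v j.+1 *m alpha j.+1)).
  apply: block_lanczos_unique lanczos erefl qr_q1 _ => j jk.
  split; [exact: is_qr_mul (qr_th j jk) (q_orth j.+1 jk) | exact: q_orth (ltnW jk)
    | | exact: three_term].
  by have [_ _ ww' _] := reg j jk; rewrite qq ww' mulmx0 mul0mx scaler0.
have bE j : (j <= k)%N -> beta j.+1 = beta' j.+1 by move=> /vqb[_ []].
(* [d] is prescribed only up to index [k], so [dd] is left free at [k.+1], where the last premise
   governs it when [K] is [k.+1]. *)
have ldl K dd : (K <= k.+1)%N -> (forall j, (j < k)%N -> dd j.+1 = d j.+1) ->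
    (K = k.+1 -> alpha k.+1 = dd k.+1 + ell k *m dd k *m (ell k)^T) ->
    block_LDLT K alpha beta ell dd.
  move=> Kk dd_d last_eq; apply/block_LDLT_entries=> j jK; split; last first.
    move=> j1K; have jk : (j < k)%N by rewrite -ltnS (leq_trans j1K).
    by rewrite bE // dd_d // ld // -dl // ld.
  have:= leq_trans jK Kk; rewrite ltnS leq_eqVlt => /predU1P[jk|jk].
    rewrite jk last_eq; first by case: (k) k_gt0.
    by apply/eqP; rewrite eqn_leq Kk -jk.
  rewrite (alphaE j jk).1 aE // dd_d //; case: j jk {jK} => [|j] jk.
    by rewrite ell0 mul0mx.
  by rewrite dl ?dd_d ?mulmxA // ltnW.
split.
- split=> [|j]; first exact: is_qr_full qr_r0.
  case: j => // j /= jk; have [_ qr_w _ _] := reg j jk.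
  split; [by have [] := alphaE j jk | by rewrite -ME Mu | exact: is_qr_full qr_w
    | exact: is_qr_full (qr_th j jk) | exact: th_unit].
- by case=> // j /= jk; rewrite (alphaE j jk).1 bE.
- split; first by apply: ldl => // /eqP; rewrite ltn_eqF.
  (* The extra diagonal block is the Schur complement forced by the last diagonal equation. *)
  exists (fun j => if j == k.+1 then alpha k.+1 - ell k *m d k *m (ell k)^T else d j).
  split=> [j /andP[_ jk]|]; first by rewrite ltn_eqF.
  apply: ldl => [//|j jk|_]; first by rewrite eqSS ltn_eqF.
  by rewrite eqxx ltn_eqF // subrK.
- move=> K ell1 d1 /andP[kK Kk] /block_LDLT_entries T1.
  have /block_LDLT_entries T0 : block_LDLT k alpha beta ell d.
    by apply: ldl => // /eqP; rewrite ltn_eqF.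
  (* Block elimination from the top: the diagonal equation fixes [d1], then the subdiagonal one
     fixes [ell1] because [d] is invertible. For [K = k.+1] this reaches [ell k]. *)
  have d_ell j : (j < k)%N -> d1 j.+1 = d j.+1 /\ ((j.+1 < K)%N -> ell1 j.+1 = ell j.+1).
    elim: j => [|j IHj] jk; have [a1 off1] := T1 _ (leq_trans jk kK);
      have [a0 _] := T0 _ jk.
    - have d11 : d1 1%N = d 1%N by move: a1; rewrite a0 !addr0.
      split=> // j1K; have [] := off1 j1K; rewrite bE // ld // d11 => + _.
      by move/(can_inj (mulmxK (du _ jk))).
    - have [dj ellj] := IHj (ltnW jk).
      have d11 : d1 j.+2 = d j.+2.
        by move: a1; rewrite a0 dj ellj ?(leq_trans jk) // => /addIr.
      split=> // j1K; have [] := off1 j1K; rewrite bE // ld // d11 => + _.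
      by move/(can_inj (mulmxK (du _ jk))).
  split; first by case=> // j /= /d_ell[].
  case=> // j /= jK; have [|_ ->//] := d_ell j.
  by rewrite -ltnS (leq_trans jK).
(* An orthogonal matrix is its own inverse transpose. *)
have -> : (invmx (theta k))^T = theta k.
  by rewrite trmx_inv -[LHS]mulmx1 -(th_orth k (leqnn k)) mulKmx // unitmx_tr th_unit.
by have [_ []] := vqb k (leqnn k).
Qed.
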